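(* Let $I\subset\mathbb{R}$ be a closed interval and let $\Phi:I\to\mathbb{R}$ be a smooth convex function such that $(u,v)\mapsto\Phi''(u)v^2$ is non-negative and convex on $I\times I$. Let $\mu$ be a probability measure on a measurable space $(\Omega,\mathcal{F})$, and let $L^{1,\Phi}(\mu)$ be the set of measurable functions $f:\Omega\to I$ such that $f\in L^1(\mu)$ and $\Phi(f)\in L^1(\mu)$. Then $L^{1,\Phi}(\mu)$ is convex, the functional $f\in L^{1,\Phi}(\mu)\mapsto\mathrm{Ent}^\Phi_\mu(f)$ is convex, and for every $f\in L^{1,\Phi}(\mu)$, $$\mathrm{Ent}^\Phi_\mu(f)=\sup_{h\in L^{1,\Phi}(\mu)}\left\{\int_\Omega\Big(\Phi'(h)-\Phi'\Big(\int h\,d\mu\Big)\Big)(f-h)\,d\mu+\mathrm{Ent}^\Phi_\mu(h)\right\}.$$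
   Context: For a probability measure $\mu$ and $f\in L^{1,\Phi}(\mu)$, $\mathrm{Ent}^\Phi_\mu(f):=\int\Phi(f)\,d\mu-\Phi\big(\int f\,d\mu\big)$. By convexity $\Phi'(h)(f-h)\le\Phi(f)-\Phi(h)$, so the integral inside the supremum is always well defined with values in $[-\infty,+\infty)$; it is understood in this sense. *)

(* Defs.v *)
From HB Require Import structures.
From mathcomp Require Import all_boot all_order all_algebra.
From mathcomp Require Import all_classical all_reals all_analysis.

Set Implicit Arguments.
Unset Strict Implicit.
Unset Printing Implicit Defensive.

Import Order.TTheory GRing.Theory Num.Theory.
Import numFieldNormedType.Exports.

Local Open Scope classical_set_scope.
Local Open Scope ring_scope.

Section derivative_within.
Context {R : realType}.
Implicit Types (I : set R) (f : R -> R) (x : R).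

(* Difference quotients are taken along points of I only, so that a function
   on I is represented by an f : R -> R whose values outside I are never used;
   at an endpoint belonging to I the derivative is the one-sided one. *)
Definition diff_quotient f x : R -> R := fun y => (f y - f x) / (y - x).

Definition derivable_within I f x : Prop :=
  cvg (diff_quotient f x @ within I x^').

Definition derive_within I f : R -> R :=
  fun x => lim (diff_quotient f x @ within I x^').

Definition derive_withinn I n f : R -> R := iter n (derive_within I) f.

(* C^oo on I: differentiability at every order already gives the continuity
   of all the derivatives on I. *)
Definition smooth_within I f : Prop :=
  forall n x, I x -> derivable_within I (derive_withinn I n f) x.

End derivative_within.

Section entropy.
Context {d : measure_display} {T : measurableType d} {R : realType}.
Implicit Types (mu : probability T R) (I : set R) (Phi : R -> R) (f : T -> R).

(* Actual functions (not classes modulo a.e. equality), with values in I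
   everywhere. *)
Definition L1Phi mu I Phi : set (T -> R^o) :=
  [set f : T -> R^o | [/\ measurable_fun setT (f : T -> R),
                          (forall x, I (f x)),
                          mu.-integrable setT (EFin \o f) &
                          mu.-integrable setT (EFin \o (Phi \o f))]].

(* Real-valued integrals: both are finite for f in L1Phi mu I Phi. *)
Definition Ent mu Phi f : R :=
  \int[mu]_x Phi (f x) - Phi (\int[mu]_x f x).

End entropy.

(* Main.v *)
Require Import Defs.
From HB Require Import structures.
From mathcomp Require Import all_boot all_order all_algebra.
From mathcomp Require Import all_classical all_reals all_analysis.
From mathcomp Require Import measurable_realfun ring lra.
Import Order.TTheory GRing.Theory Num.Theory.
Import numFieldNormedType.Exports.
Local Open Scope classical_set_scope.
Local Open Scope ring_scope.

(* Let D(y,x) = Phi y - Phi x - Phi' x (y - x).  With a = E h and b = E f,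
     Ent f - Ent h - E[(Phi' h - Phi' a)(f - h)] = E D(f,h) - D(b,a),
   so the duality formula (attained at h = f) is Jensen's inequality for D, and
   it follows by integrating a tangent plane inequality for D at (b,a).  D is
   jointly convex because the second derivative of D along a segment is exactly
   the gap in the tangent inequality of C(u,v) = Phi''(u) v^2, with slopes v
   ranging over all of R: the Hessian of C is homogeneous in v, hence its
   positivity for v in I gives positivity for every v.  Since Phi is smooth up
   to the endpoints of I, no special treatment of endpoints is needed. *)

(** * Derivatives relative to an interval versus ordinary ones *)

Section derivative_within_lemmas.
Context {R : realType}.
Implicit Types (I : set R) (f : R -> R) (x y s : R).

(** Write [f y = f x + diff_quotient f x y * (y - x)]: the quotient converges and [y - x] tends to
    0. The quotient lives on the punctured filter, so [y = x] is added back at the end. *)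
Lemma derivable_within_cvg I f x :
  derivable_within I f x -> f @ within I (nbhs x) --> f x.
Proof.
move=> df A Afx.
have FF : Filter (within I x^') by exact: within_filter.
(* The filter may be improper: at an isolated point of [I] the punctured filter is trivial. *)
have H (F : set_system R) (l : R) : Filter F -> F --> x ->
    (\forall y \near F, y != x) -> diff_quotient f x @ F --> l -> f @ F --> f x.
  move=> FF0 Fx neqx ql.
  have H : (fun y => f x + diff_quotient f x y * (y - x)) @ F --> f x.
    rewrite -[X in _ --> X]addr0 -[X in _ + X](mulr0 l) -[X in _ * X](subrr x).
    apply: cvgD; first exact: cvg_cst.
    by apply: cvgM => //; apply: cvgB => //; exact: cvg_cst.
  apply: cvg_trans H; apply: near_eq_cvg; near=> y.
  rewrite /diff_quotient divfK ?subr_eq0; first by rewrite addrC subrK.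
  by near: y.
have := H _ _ FF (cvg_trans (@cvg_within _ _ _ I) (@nbhs_dnbhs _ x)) _ df.
have -> : (\forall y \near within I x^', y != x) = True.
  rewrite near_withinE propeqE; split=> // _.
  by near=> y => _; near: y; exact: nbhs_dnbhs_neq.
move=> /(_ _ Logic.I A Afx) nA.
have {}nA : \forall y \near x, y != x -> I y -> A (f y) by exact: nA.
suff : \forall y \near x, I y -> A (f y) by [].
near=> y => Iy; have [->|yx] := eqVneq y x; first exact: nbhs_singleton.
by move: Iy; move: yx; near: y.
Unshelve. all: by end_near. Qed.

(** At an interior point, restricting the punctured filter to [I] changes nothing, and the
    substitution [y = h + x] gives the usual quotient. *)
Lemma is_derive_derive_within I f x : nbhs x I -> derivable_within I f x ->
  is_derive x 1 f (derive_within I f x).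
Proof.
move=> xI df.
have E : within I x^' = x^'.
  rewrite eqEsubset; split => A; rewrite /within/= => nA.
    near=> y; have : I y by near: y; apply: nbhs_dnbhs.
    by near: y.
  by near=> y => _; near: y.
move: df; rewrite /derivable_within /derive_within E => df.
have {}df : h^-1 *: ((f \o shift x) h%:A - f x) @[h --> 0^'] -->
    lim (diff_quotient f x @ x^').
  suff -> : (fun h => h^-1 *: ((f \o shift x) h%:A - f x)) =
      diff_quotient f x \o shift x.
    move=> A /df nA.
    have {}nA : \forall y \near x, y != x -> A (diff_quotient f x y).
      by exact: nA.
    suff : \forall h \near 0, h != 0 -> A (diff_quotient f x (h + x)) by [].
    rewrite (near_shift x 0) sub0r; near=> y => /=.
    by rewrite subrK subr_eq0; near: y.
  apply/funext => h; rewrite /diff_quotient/= addrK.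
  by rewrite [h%:A]mulr1 mulrC.
by apply: DeriveDef; [apply/cvg_ex; eexists; exact: df | exact/cvg_lim].
Unshelve. all: by end_near. Qed.

End derivative_within_lemmas.

(** * Second-order criteria in one variable *)

Section second_order.
Context {R : realType}.
Implicit Types (k : R -> R).

(** Two mean values: [k 1 - k 0 = k1 c] and [k1 c - k1 0 = k2 b * c]. Derivatives are taken only in
    the open interval because the paths used later may start or end at an endpoint of [I]. *)
Lemma tangent_le_of_derive2_ge0 k (k1 k2 : R -> R) :
  {within `[(0 : R), 1], continuous k} -> {within `[0, 1], continuous k1} ->
  (forall s : R, s \in `]0, 1[ -> is_derive s 1 k (k1 s)) ->
  (forall s : R, s \in `]0, 1[ -> is_derive s 1 k1 (k2 s)) ->
  (forall s : R, s \in `]0, 1[ -> 0 <= k2 s) ->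
  k 0 + k1 0 <= k 1.
Proof.
move=> kc k1c dk dk1 k2_ge0.
have [c c01 kE] := MVT ltr01 dk kc.
have /andP[c0 c1] : 0 < c < 1 by move: c01; rewrite in_itv.
have sub0c : `[0, c] `<=` `[0, 1].
  by apply: subset_itvl; rewrite bnd_simp ltW.
have dk1c s : s \in `]0, c[ -> is_derive s 1 k1 (k2 s).
  move=> sc; apply: dk1; move: sc; rewrite !in_itv/= => /andP[-> sc].
  exact: lt_trans c1.
have [b bc k1E] := MVT c0 dk1c (continuous_subspaceW sub0c k1c).
have : 0 <= k2 b.
  apply: k2_ge0; move: bc; rewrite !in_itv/= => /andP[-> bc].
  exact: lt_trans c1.
by nra.
Qed.

(** If [l < 0], then [k1 c < k1 0 < k1 b] for small [b < 0 < c]; the mean values of [k] on [[0, t]]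
    and [[- t, 0]] then give [k t + k (- t) < 2 * k 0]. *)
Lemma derive2_ge0_of_midconvex k (k1 : R -> R) (l e : R) : 0 < e ->
  (forall s : R, `|s| < e -> is_derive s 1 k (k1 s)) ->
  is_derive (0 : R) 1 k1 l ->
  (forall s : R, `|s| < e -> 2 * k 0 <= k s + k (- s)) ->
  0 <= l.
Proof.
move=> e0 dk [dk1 dk1E] kmid; rewrite leNgt; apply/negP => l0.
have : \forall h \near (0 : R)^', h^-1 * (k1 h - k1 0) < 0.
  apply: (cvgr_lt l) => //; rewrite -dk1E.
  have -> : (fun h => h^-1 * (k1 h - k1 0)) =
     (fun h => h^-1 *: ((k1 \o shift 0) h%:A - k1 0)).
    by apply/funext => h /=; rewrite addr0 [h%:A]mulr1.
  exact: dk1.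
move=> [r /= r0 Hr].
have {}Hr h : `|h| < r -> h != 0 -> h^-1 * (k1 h - k1 0) < 0.
  by move=> hr; apply: Hr; rewrite /ball/= sub0r normrN.
pose t := Num.min r e / 2.
have t0 : 0 < t by rewrite divr_gt0// lt_min r0.
have tr : t < r.
  by have : Num.min r e <= r; [rewrite ge_min lexx | rewrite /t; lra].
have te : t < e.
  by have : Num.min r e <= e; [rewrite ge_min lexx orbT | rewrite /t; lra].
have dkt s : s \in `](- t), t[ -> is_derive s 1 k (k1 s).
  rewrite in_itv/= -ltr_norml => st; apply: dk; exact: lt_trans te.
have kct (a b : R) : - t <= a -> b <= t -> {within `[a, b], continuous k}.
  move=> ta bt; apply: derivable_within_continuous => s.
  rewrite in_itv/= => /andP[sa sb].
  have : `|s| < e by rewrite (le_lt_trans _ te)// ler_norml; lra.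
  by move=> /dk[].
have dkl (a b : R) : - t <= a -> b <= t ->
    forall s, s \in `]a, b[ -> is_derive s 1 k (k1 s).
  move=> ta bt s; rewrite in_itv/= => /andP[sa sb]; apply: dkt.
  by rewrite in_itv/= (le_lt_trans ta sa) (lt_le_trans sb bt).
have nt0 : - t < 0 by rewrite oppr_lt0.
have [c ct cE] :=
  MVT t0 (dkl _ _ (ltW nt0) (lexx t)) (kct _ _ (ltW nt0) (lexx t)).
have [b bt bE] :=
  MVT nt0 (dkl _ _ (lexx _) (ltW t0)) (kct _ _ (lexx _) (ltW t0)).
have c_lt : k1 c < k1 0.
  move: ct; rewrite in_itv/= => /andP[c0 ct].
  have := Hr c; rewrite gtr0_norm// pmulr_rlt0 ?invr_gt0// subr_lt0; apply.
    exact: lt_trans tr.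
  by rewrite gt_eqF.
have b_gt : k1 0 < k1 b.
  move: bt; rewrite in_itv/= => /andP[tb b0].
  have := Hr b; rewrite ltr0_norm// nmulr_rlt0 ?invr_lt0// subr_gt0; apply.
    by rewrite ltrNl (lt_trans _ tb)// ltrN2.
  by rewrite lt_eqF.
have := kmid t; rewrite gtr0_norm// => /(_ te).
have : k1 c * t < k1 b * t by rewrite ltr_pM2r// (lt_trans c_lt).
by move: cE bE; rewrite subr0 sub0r opprK; lra.
Qed.

End second_order.

(** * Paths along segments of the interval *)

Section segments.
Context {R : realType}.
Variables (I : set R) (I_itv : is_interval I).
Implicit Types (f : R -> R) (x y s : R).

Definition seg x y s : R := x + s * (y - x).

Lemma seg0 x y : seg x y 0 = x. Proof. by rewrite /seg mul0r addr0. Qed.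

Lemma seg1 x y : seg x y 1 = y. Proof. by rewrite /seg mul1r addrC subrK. Qed.

Lemma is_derive_seg x y s : is_derive s 1 (seg x y) (y - x).
Proof.
have -> : seg x y = cst x + (y - x) \*: id.
  by apply/funext => t; rewrite /seg/= -[RHS]/(x + (y - x) * t) mulrC.
by apply: is_derive_eq; rewrite add0r; exact: mulr1.
Qed.

Lemma continuous_seg (x y s : R) : {for s, continuous (seg x y)}.
Proof.
apply/differentiable_continuous/derivable1_diffP.
by case: (is_derive_seg x y s).
Qed.

Lemma near_seg (P : R -> Prop) (x y s : R) :
  (\forall z \near seg x y s, P z) -> \forall t \near s, P (seg x y t).
Proof. by move=> nP; exact: (continuous_seg x y s _ nP). Qed.

Lemma mem_seg x y s : I x -> I y -> 0 <= s <= 1 -> I (seg x y s).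
Proof.
move=> Ix Iy /andP[s0 s1]; rewrite /seg.
have [xy|yx] := leP x y.
  by apply: (I_itv x y Ix Iy); apply/andP; split; nra.
by apply: (I_itv y x Iy Ix); apply/andP; split; nra.
Qed.

(** Makes derivatives relative to [I] two-sided inside the segment, even when [x] or [y] is an
    endpoint of [I]. *)
Lemma nbhs_seg x y s : I x -> I y -> x != y -> s \in `]0, 1[ ->
  nbhs (seg x y s) I.
Proof.
move=> Ix Iy xy; rewrite in_itv/= => /andP[s0 s1].
have H a b z : I a -> I b -> z \in `]a, b[ -> nbhs z I.
  move=> Ia Ib /near_in_itvoo; apply: filterS => w.
  by rewrite in_itv/= => /andP[aw wb]; apply: (I_itv a b Ia Ib); rewrite !ltW.
have [lt_xy|lt_yx|/eqP] := ltgtP x y; last by rewrite (negbTE xy).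
  by apply: (H x y) => //; rewrite in_itv/= /seg; apply/andP; split; nra.
by apply: (H y x) => //; rewrite in_itv/= /seg; apply/andP; split; nra.
Qed.

Lemma within_continuous_seg f x y : (forall z, I z -> derivable_within I f z) ->
  I x -> I y -> {within `[(0 : R), 1], continuous (f \o seg x y)}.
Proof.
move=> df Ix Iy; apply/subspace_continuousP => s; rewrite /= in_itv/= => s01 A.
have Is := mem_seg _ _ _ Ix Iy s01.
move=> /(derivable_within_cvg _ _ _ (df _ Is)) nA.
have {}nA : \forall z \near seg x y s, I z -> A (f z) by exact: nA.
suff : \forall t \near s, t \in `[0, 1] -> A (f (seg x y t)) by [].
have nB := near_seg _ _ _ _ nA.
near=> t => t01.
suff It : I (seg x y t) by move: It; near: t.
by apply: (mem_seg _ _ _ Ix Iy); move: t01; rewrite in_itv.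
Unshelve. all: by end_near. Qed.

Lemma is_derive_seg_comp f x y s : (forall z, I z -> derivable_within I f z) ->
  I x -> I y -> s \in `]0, 1[ ->
  is_derive s 1 (f \o seg x y) ((y - x) * derive_within I f (seg x y s)).
Proof.
move=> df Ix Iy s01; have [->|xy] := eqVneq x y.
  (* A constant path may sit at an endpoint of [I], where [f] has no two-sided derivative; the
     composite is then constant. *)
  rewrite subrr mul0r; have -> : f \o seg y y = cst (f y).
    by apply/funext => t; rewrite /= /seg subrr mulr0 addr0.
  exact: is_derive_cst.
rewrite mulrC; apply: is_derive1_comp; last exact: is_derive_seg.
apply: is_derive_derive_within; first exact: nbhs_seg.
by apply: df; apply: mem_seg => //; move: s01; rewrite !in_itv/=; lra.
Qed.

End segments.

(** * Tangent inequality for [C(u,v) = phi u * v ^+ 2] *)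

Section quadratic_form.
Context {R : realType}.
Variables (I : set R) (I_itv : is_interval I) (phi : R -> R).
Let dphi := derive_within I phi.
Let ddphi := derive_within I dphi.
Hypothesis phi_derivable : forall z, I z -> derivable_within I phi z.
Hypothesis dphi_derivable : forall z, I z -> derivable_within I dphi z.
Hypothesis midconvex : forall u v u' v', I u -> I v -> I u' -> I v' ->
  2 * (phi ((u + u') / 2) * ((v + v') / 2) ^+ 2) <=
  phi u * v ^+ 2 + phi u' * v' ^+ 2.

(* [(v a', b)^T Hess (v a', b)] at [(u, v)] for [C(u,v) = phi u * v^2] and
   [a' = a / v]: the dependence on [v] disappears, so that one [v != 0] in the
   interior of I controls all directions. *)
Lemma hessian_ge0 (u a b : R) : nbhs u I ->
  0 <= ddphi u * a ^+ 2 + 4 * dphi u * a * b + 2 * phi u * b ^+ 2.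
Proof.
move=> uI.
(* [v = u] serves unless [u = 0]; then a small positive point does. *)
have [v v0 vI] : exists2 v : R, v != 0 & nbhs v I.
  have [u0|u0] := eqVneq u 0; last by exists u.
  have [r /= r0 rI] := (nbhs_interior uI : nbhs u (interior I)).
  exists (r / 2); first by rewrite gt_eqF// divr_gt0.
  apply: rI; rewrite /ball/= u0 sub0r normrN gtr0_norm ?divr_gt0//.
  by rewrite ltr_pdivrMr//; lra.
(* The first path must stay in the interior, where [phi] is differentiated; the second one in [I],
   where midpoint convexity applies. *)
have [e e0 eI] : exists2 e : R, 0 < e & forall s, `|s| < e ->
    nbhs (seg u (u + a / v) s) I /\ I (seg v (v + b) s).
  have uI' : nbhs (seg u (u + a / v) 0) (interior I).
    by rewrite seg0; exact: nbhs_interior.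
  have vI' : nbhs (seg v (v + b) 0) I by rewrite seg0.
  have [e /= e0 eI] := filterI (near_seg _ _ _ _ uI') (near_seg _ _ _ _ vI').
  by exists e => // s se; apply: eI; rewrite /ball/= sub0r normrN.
pose U := seg u (u + a / v); pose V := seg v (v + b).
have dU (s : R) : is_derive s 1 U (a / v).
  by apply: is_derive_eq (is_derive_seg _ _ _) _; rewrite addrC addKr.
have dV (s : R) : is_derive s 1 V b.
  by apply: is_derive_eq (is_derive_seg _ _ _) _; rewrite addrC addKr.
have dcomp (f : R -> R) (s : R) :
    (forall z, I z -> derivable_within I f z) -> `|s| < e ->
    is_derive s 1 (f \o U) (derive_within I f (U s) * (a / v)).
  move=> df se; apply: is_derive1_comp; apply: is_derive_derive_within.
    exact: (eI s se).1.
  by apply: df; apply: nbhs_singleton; exact: (eI s se).1.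
(* This is [C] along the line through [(u, v)] with direction [(a / v, b)]; its second derivative at
   0 is the Hessian form. *)
pose k := (phi \o U) * (V * V).
pose k1 := (dphi \o U) * ((a / v) *: (V * V)) + (phi \o U) * ((2 * b) *: V).
have dk (s : R) : `|s| < e -> is_derive s 1 k (k1 s).
  move=> se; have dphis := dcomp phi s phi_derivable se.
  apply: is_derive_eq; rewrite /k1 !fctE /GRing.scale/= -/dphi.
  by ring.
have dk1 : is_derive (0 : R) 1 k1
    (ddphi u * a ^+ 2 + 4 * dphi u * a * b + 2 * phi u * b ^+ 2).
  have e0' : `|0 : R| < e by rewrite normr0.
  have dphi0 := dcomp phi 0 phi_derivable e0'.
  have ddphi0 := dcomp dphi 0 dphi_derivable e0'.
  apply: is_derive_eq; rewrite !fctE /GRing.scale/= /U /V !seg0 -/dphi -/ddphi.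
  by field.
(* The points with parameters [s] and [- s] have midpoint [(u, v)]. *)
apply: (derive2_ge0_of_midconvex _ _ _ _ e0 dk dk1) => s se.
have se' : `|- s| < e by rewrite normrN.
have [/nbhs_singleton Us Vs] := eI _ se.
have [/nbhs_singleton Us' Vs'] := eI _ se'.
have := midconvex _ _ _ _ Us Vs Us' Vs'.
rewrite /k !fctE /U /V !seg0 /= -!expr2.
have -> : (seg u (u + a / v) s + seg u (u + a / v) (- s)) / 2 = u.
  by rewrite /seg; field.
have -> : (seg v (v + b) s + seg v (v + b) (- s)) / 2 = v.
  by rewrite /seg; field.
by [].
Qed.

Hypothesis phi_ge0 : forall u, I u -> 0 <= phi u.

(** Along the segment from [(x, q)] to [(y, p)], the second derivative of [C] is the form of
    [hessian_ge0] with [a = V s * (y - x)] and [b = p - q]. The slopes [p] and [q] are arbitrary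
    reals because they will be differences of points of [I]. *)
Lemma tangent_quadratic (x y p q : R) : I x -> I y ->
  phi x * q ^+ 2 + dphi x * q ^+ 2 * (y - x) + 2 * phi x * q * (p - q) <=
  phi y * p ^+ 2.
Proof.
move=> Ix Iy.
pose U := seg x y; pose V := seg q p.
pose k := (phi \o U) * (V * V).
pose k1 := (dphi \o U) * ((y - x) *: (V * V)) +
  (phi \o U) * ((2 * (p - q)) *: V).
pose k2 (s : R) := ddphi (U s) * (V s * (y - x)) ^+ 2 +
  4 * dphi (U s) * (V s * (y - x)) * (p - q) + 2 * phi (U s) * (p - q) ^+ 2.
have phiUc := within_continuous_seg _ I_itv phi x y phi_derivable Ix Iy.
have dphiUc := within_continuous_seg _ I_itv dphi x y dphi_derivable Ix Iy.
have Vc : {within `[(0 : R), 1], continuous V}.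
  by apply: continuous_subspaceT => s; exact: continuous_seg.
suff : k 0 + k1 0 <= k 1.
  by rewrite /k /k1 !fctE /GRing.scale/= /U /V !seg0 !seg1; nra.
refine (tangent_le_of_derive2_ge0 k k1 k2 _ _ _ _ _).
- by move=> s; apply: cvgM; [exact: phiUc | apply: cvgM; exact: Vc].
- move=> s; apply: cvgD; apply: cvgM; [exact: dphiUc| |exact: phiUc|].
  + by apply: cvgZr; apply: cvgM; exact: Vc.
  + by apply: cvgZr; exact: Vc.
- move=> s s01.
  have dphis := is_derive_seg_comp _ I_itv phi x y s phi_derivable Ix Iy s01.
  have dVs := is_derive_seg q p s.
  apply: is_derive_eq; rewrite /k1 !fctE /GRing.scale/= -/dphi.
  by ring.
- move=> s s01.
  have dphis := is_derive_seg_comp _ I_itv phi x y s phi_derivable Ix Iy s01.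
  have ddphis := is_derive_seg_comp _ I_itv dphi x y s dphi_derivable Ix Iy s01.
  have dVs := is_derive_seg q p s.
  apply: is_derive_eq; rewrite /k2 !fctE /GRing.scale/= -/dphi -/ddphi.
  by ring.
(* For [x = y] the path may sit at an endpoint of [I], out of reach of [hessian_ge0]; only the term
   in [(p - q) ^+ 2] remains. *)
- move=> s s01; rewrite /k2; have [xy|xy] := eqVneq x y.
    rewrite xy subrr !mulr0 expr0n mulr0 !mul0r !add0r mulr_ge0 ?sqr_ge0//.
    by rewrite mulr_ge0// phi_ge0// /U xy /seg subrr mulr0 addr0.
  by apply: hessian_ge0; exact: nbhs_seg.
Qed.

End quadratic_form.

(** * Tangent planes of the Bregman divergence *)

Section bregman_divergence.
Context {R : realType}.
Variables (I : set R) (I_itv : is_interval I) (Phi : R -> R).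
Hypothesis Phi_smooth : smooth_within I Phi.
Hypothesis Phi2_ge0 : forall u v : R, I u -> I v ->
  0 <= derive_withinn I 2 Phi u * v ^+ 2.
Hypothesis Phi2_convex : @convex_function R (R^o * R^o)%type (I `*` I)
  (fun p : R * R => derive_withinn I 2 Phi p.1 * p.2 ^+ 2).

Let dPhi := derive_within I Phi.
Let phi := derive_within I dPhi.
Let dphi := derive_within I phi.

Definition bregman (y x : R) : R :=
  Phi y - Phi x - derive_within I Phi x * (y - x).

(** The convexity hypothesis at weight 1/2, built by hand as an element of the unit interval
    type. *)
Let phi_midconvex u v u' v' : I u -> I v -> I u' -> I v' ->
  2 * (phi ((u + u') / 2) * ((v + v') / 2) ^+ 2) <=
  phi u * v ^+ 2 + phi u' * v' ^+ 2.
Proof.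
move=> Iu Iv Iu' Iv'.
have h01 : Itv.spec (@Itv.num_sem R) (Itv.Real `[0%Z, 1%Z]%Z) (2^-1 : R).
  by apply/andP; split; [rewrite num_real | rewrite in_itv/=; lra].
have := Phi2_convex (Itv.Def h01) (u, v) (u', v').
rewrite !inE/= => /(_ (conj Iu Iv) (conj Iu' Iv')).
rewrite convRE /conv/= /GRing.scale/= /unstable.onem.
have -> : 1 - 2^-1 = 2^-1 :> R by lra.
rewrite -!mulrDr [2^-1 * (u + u')]mulrC [2^-1 * (v + v')]mulrC.
by rewrite -/dPhi -/phi; lra.
Qed.

(** The partial derivatives of [bregman] at [(b, a)] are [dPhi b - dPhi a] and [- phi a * (b - a)],
    so the left side is the tangent plane there. It lies below because the second derivative along
    the segment to [(y, x)] is nonnegative. *)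
Lemma bregman_tangent (x y a b : R) : I x -> I y -> I a -> I b ->
  bregman b a + (dPhi b - dPhi a) * (y - b) - phi a * (b - a) * (x - a) <=
  bregman y x.
Proof.
move=> Ix Iy Ia Ib.
(* On I = {0} the hypothesis [Phi2_ge0] does not bound the junk value [phi 0]. *)
have [v0|] := pselect (exists2 v, I v & v != 0); last first.
  move=> I0; have {}I0 z : I z -> z = 0.
    by move=> Iz; apply/eqP/negPn/negP => z0; apply: I0; exists z.
  by rewrite (I0 x)// (I0 y)// (I0 a)// (I0 b)// /bregman; lra.
have phi_ge0 u : I u -> 0 <= phi u.
  move=> Iu; have [v Iv v_neq0] := v0.
  have := Phi2_ge0 _ _ Iu Iv; rewrite pmulr_lge0//.
  by rewrite lt_def sqrf_eq0 v_neq0 sqr_ge0.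
(* [Phi_smooth n] provides the derivative of order [n + 1]; the Hessian of [C] involves the fourth
   derivative of [Phi]. *)
have Phi_der : forall z, I z -> derivable_within I Phi z := Phi_smooth 0.
have dPhi_der : forall z, I z -> derivable_within I dPhi z := Phi_smooth 1.
have phi_der : forall z, I z -> derivable_within I phi z := Phi_smooth 2.
have dphi_der : forall z, I z -> derivable_within I dphi z := Phi_smooth 3.
pose X := seg a x; pose Y := seg b y; pose p := y - b; pose q := x - a.
pose k := (Phi \o Y) - (Phi \o X) - (dPhi \o X) * (Y - X).
pose k1 := p *: (dPhi \o Y) - p *: (dPhi \o X) - q *: ((phi \o X) * (Y - X)).
pose k2 (s : R) := p * (p * phi (Y s)) - p * (q * phi (X s)) -
  q * (q * dphi (X s) * (Y s - X s) + phi (X s) * (p - q)).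
have cX f : (forall z, I z -> derivable_within I f z) ->
    {within `[(0 : R), 1], continuous (f \o X)}.
  by move=> df; exact: (within_continuous_seg _ I_itv f a x df Ia Ix).
have cY f : (forall z, I z -> derivable_within I f z) ->
    {within `[(0 : R), 1], continuous (f \o Y)}.
  by move=> df; exact: (within_continuous_seg _ I_itv f b y df Ib Iy).
have cYX : {within `[(0 : R), 1], continuous (Y - X)}.
  by apply: continuous_subspaceT => s; apply: cvgB; exact: continuous_seg.
have dX f (s : R) : (forall z, I z -> derivable_within I f z) ->
    s \in `]0, 1[ -> is_derive s 1 (f \o X) (q * derive_within I f (X s)).
  by move=> df; exact: (is_derive_seg_comp _ I_itv f a x s df Ia Ix).
have dY f (s : R) : (forall z, I z -> derivable_within I f z) ->
    s \in `]0, 1[ -> is_derive s 1 (f \o Y) (p * derive_within I f (Y s)).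
  by move=> df; exact: (is_derive_seg_comp _ I_itv f b y s df Ib Iy).
have dYX (s : R) : is_derive s 1 (Y - X) (p - q).
  have dYs := is_derive_seg b y s; have dXs := is_derive_seg a x s.
  exact: is_deriveB.
suff : k 0 + k1 0 <= k 1.
  rewrite /k /k1 !fctE /GRing.scale/= /X /Y !seg0 !seg1 /bregman -/dPhi /p /q.
  lra.
refine (tangent_le_of_derive2_ge0 k k1 k2 _ _ _ _ _).
- move=> s; apply: cvgB; last by apply: cvgM; [exact: cX | exact: cYX].
  by apply: cvgB; [exact: cY | exact: cX].
- move=> s; apply: cvgB.
    by apply: cvgB; apply: cvgZr; [exact: cY | exact: cX].
  by apply: cvgZr; apply: cvgM; [exact: cX | exact: cYX].
- move=> s s01; have dPY := dY _ _ Phi_der s01.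
  have dPX := dX _ _ Phi_der s01; have ddPX := dX _ _ dPhi_der s01.
  apply: is_derive_eq; rewrite /k1 !fctE /GRing.scale/= -/dPhi -/phi /p /q.
  by ring.
- move=> s s01; have dPY := dY _ _ dPhi_der s01.
  have dPX := dX _ _ dPhi_der s01; have ddPX := dX _ _ phi_der s01.
  apply: is_derive_eq; rewrite /k2 !fctE /GRing.scale/= -/dPhi -/phi -/dphi /p /q.
  by ring.
- move=> s s01.
  have s01' : 0 <= s <= 1 by move: s01; rewrite in_itv/=; lra.
  have IX : I (X s) by exact: mem_seg.
  have IY : I (Y s) by exact: mem_seg.
  (* [k2 s] is exactly the gap between [C] at [(Y s, p)] and its tangent plane at [(X s, q)]. *)
  have := tangent_quadratic I I_itv phi phi_der dphi_der phi_midconvex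
    phi_ge0 (X s) (Y s) p q IX IY.
  by rewrite /k2 -/dphi; lra.
Qed.

End bregman_divergence.

(** * Means under a probability measure *)

Section means.
Context {d : measure_display} {T : measurableType d} {R : realType}.
Variable mu : probability T R.
Implicit Types (f g : T -> R) (m n : R).

(** Integrability and the value of the integral are bundled so that both propagate together through
    linear combinations. *)
Definition has_mean f m : Prop :=
  mu.-integrable setT (EFin \o f) /\ \int[mu]_x f x = m.

Lemma has_meanD f g m n : has_mean f m -> has_mean g n ->
  has_mean (fun x => f x + g x) (m + n).
Proof.
move=> [fi <-] [gi <-]; split; last by rewrite RintegralD.
exact: (integrableD measurableT fi gi).
Qed.

Lemma has_meanZ f m c : has_mean f m -> has_mean (fun x => c * f x) (c * m).
Proof.
move=> [fi <-]; split; last by rewrite RintegralZl.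
exact: (integrableZl measurableT c fi).
Qed.

Lemma has_mean_cst c : has_mean (fun=> c) c.
Proof.
split; first exact: finite_measure_integrable_cst.
rewrite (Rintegral_cst mu measurableT) -[RHS]mulr1; congr (_ * _).
by rewrite -[RHS]/(fine 1%E); congr fine; exact: probability_setT.
Qed.

Lemma has_meanB f g m n : has_mean f m -> has_mean g n ->
  has_mean (fun x => f x - g x) (m - n).
Proof.
move=> [fi <-] [gi <-]; split; last by rewrite RintegralB.
exact: (integrableB measurableT fi gi).
Qed.

(** Removes the linear terms of a tangent inequality taken at the means. *)
Lemma has_mean_centered f m c : has_mean f m ->
  has_mean (fun x => c * (f x - m)) 0.
Proof.
move=> fm; rewrite -[X in has_mean _ X](mulr0 c) -[X in _ * X](subrr m).
exact/has_meanZ/has_meanB/has_mean_cst.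
Qed.

Lemma le_has_mean f g m n : has_mean f m -> has_mean g n ->
  (forall x, f x <= g x) -> m <= n.
Proof. by move=> [fi <-] [gi <-] fg; apply: le_Rintegral. Qed.

(** The function is dominated by [|l| + |u|]. *)
Lemma integrable_sandwich l u f : measurable_fun setT f ->
  mu.-integrable setT (EFin \o l) -> mu.-integrable setT (EFin \o u) ->
  (forall x, l x <= f x <= u x) -> mu.-integrable setT (EFin \o f).
Proof.
move=> mf li ui lfu.
apply: (le_integrable measurableT (g := EFin \o (fun x => `|l x| + `|u x|))).
- exact/measurable_EFinP.
- move=> x _; rewrite /= lee_fin [leRHS]ger0_norm ?addr_ge0//.
  have /andP[lf fu] := lfu x; rewrite ler_norml.
  have := ler_norm (u x); have := ler_norm (- l x); rewrite normrN.
  by have := normr_ge0 (l x); have := normr_ge0 (u x); lra.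
- exact: (integrableD measurableT (integrable_norm li) (integrable_norm ui)).
Qed.

(** The integral of [f] may be minus infinity, so positive and negative parts are compared
    separately. *)
Lemma integral_le_has_mean f g m : measurable_fun setT f -> has_mean g m ->
  (forall x, f x <= g x) -> (\int[mu]_x (f x)%:E <= m%:E)%E.
Proof.
move=> mf [gi <-] fg.
have -> : (\int[mu]_x g x)%:E = (\int[mu]_x (g x)%:E)%E.
  by rewrite /Rintegral fineK//; exact: integrable_fin_num.
have mf' : measurable_fun setT (EFin \o f) by exact/measurable_EFinP.
have mg := measurable_int mu gi.
have fg' : {in setT, forall x, ((EFin \o f) x <= (EFin \o g) x)%E}.
  by move=> x _; rewrite /= lee_fin.
rewrite integralE [leRHS]integralE; apply: leeB; apply: ge0_le_integral => //.
- exact: measurable_funepos.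
- exact: measurable_funepos.
- by move=> x _; apply: (funepos_le fg'); rewrite inE.
- exact: measurable_funeneg.
- exact: measurable_funeneg.
- by move=> x _; apply: (funeneg_le fg'); rewrite inE.
Qed.

(** If [m] is outside the closed set [I], a ball of radius [e] around [m] misses [I]. The interval
    then lies on one side of [m], and the mean would differ from [m] by at least [e]. *)
Lemma mem_mean (I : set R) f m : is_interval I -> closed I ->
  (forall x, I (f x)) -> has_mean f m -> I m.
Proof.
move=> I_itv I_closed fI fm; apply: contrapT => nIm.
have [e /= e0 eI] : nbhs m (~` I).
  by apply: open_nbhs_nbhs; split => //; rewrite openC.
have far x : f x <= m - e \/ m + e <= f x.
  have [|lt1] := leP (f x) (m - e); first by left.
  have [|lt2] := leP (m + e) (f x); first by right.
  exfalso; apply: (eI (f x)); last exact: fI.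
  by rewrite /ball/= ltr_norml; lra.
(* Total mass 1 forces a point to exist; its value decides the side. *)
have [x0 _] : [set: T] !=set0.
  apply/set0P/negP => /eqP T0; have := probability_setT mu.
  by rewrite T0 measure0 => /esym/eqP; rewrite onee_eq0.
have same x y : f x <= m - e -> m + e <= f y -> False.
  by move=> fx fy; apply: nIm; apply: (I_itv _ _ (fI x) (fI y)); lra.
case: (far x0) => fx0.
  have : m <= m - e; last lra.
  apply: (le_has_mean _ _ _ _ fm (has_mean_cst _)) => x.
  by case: (far x) => // /(same x0 x fx0).
have : m + e <= m; last lra.
apply: (le_has_mean _ _ _ _ (has_mean_cst _) fm) => x.
by case: (far x) => // fx; case: (same x x0 fx fx0).
Qed.

End means.

(** * Measurability of compositions *)

Section measurability.
Context {d : measure_display} {T : measurableType d} {R : realType}.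

(** [F] is uncontrolled outside [I], so measurability comes from its continuity on the measurable
    set [I], which contains the values of [f]. *)
Lemma measurable_derivable_within_comp (I : set R) (F : R -> R) (f : T -> R) :
  is_interval I -> (forall z, I z -> derivable_within I F z) ->
  measurable_fun setT f -> (forall x, I (f x)) ->
  measurable_fun setT (F \o f).
Proof.
move=> I_itv dF mf fI.
have mI := is_interval_measurable I_itv.
apply: (measurable_comp mI _ _ mf); first by move=> _ [x _ <-].
apply: subspace_continuous_measurable_fun => //.
apply/subspace_continuousP => z Iz.
exact: (derivable_within_cvg _ _ _ (dF z Iz)).
Qed.

End measurability.

(** * Convexity of the entropy and the variational bound *)

Section L1Phi_theory.
Context {d : measure_display} {T : measurableType d} {R : realType}.
Variable mu : probability T R.
Variables (I : set R) (I_itv : is_interval I) (I_closed : closed I).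
Variable Phi : R -> R.
Hypothesis Phi_smooth : smooth_within I Phi.
Hypothesis Phi_convex : @convex_function R R^o I Phi.
Hypothesis Phi2_ge0 : forall u v : R, I u -> I v ->
  0 <= derive_withinn I 2 Phi u * v ^+ 2.
Hypothesis Phi2_convex : @convex_function R (R^o * R^o)%type (I `*` I)
  (fun p : R * R => derive_withinn I 2 Phi p.1 * p.2 ^+ 2).
Implicit Types (f g h : T -> R).

Let dPhi := derive_within I Phi.
Let phi := derive_within I dPhi.
Let tangent := bregman_tangent I I_itv Phi Phi_smooth Phi2_ge0 Phi2_convex.

Lemma L1Phi_has_mean f : L1Phi mu I Phi f -> has_mean mu f (\int[mu]_x f x).
Proof. by case. Qed.

Lemma L1Phi_has_mean_comp f : L1Phi mu I Phi f ->
  has_mean mu (Phi \o f) (\int[mu]_x Phi (f x)).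
Proof. by case. Qed.

Lemma L1Phi_mean_mem f : L1Phi mu I Phi f -> I (\int[mu]_x f x).
Proof.
by case=> _ fI fi _; apply: (mem_mean mu I f) => //; split.
Qed.

(** Integrability of [Phi \o h] follows by squeezing it between a tangent line of [Phi] and the
    convex combination of [Phi \o f] and [Phi \o g]. *)
Lemma L1Phi_conv (t : {i01 R}) f g : L1Phi mu I Phi f -> L1Phi mu I Phi g ->
  L1Phi mu I Phi (fun x => t%:num * f x + (1 - t%:num) * g x).
Proof.
move=> Lf Lg; have [mf fI fi Pfi] := Lf; have [mg gI gi Pgi] := Lg.
have t0 : 0 <= t%:num by [].
have t1 : t%:num <= 1 by [].
set h := fun x => _.
have mh : measurable_fun setT (h : T -> R).
  by apply: measurable_funD; apply: measurable_funM.
have hI x : I (h x).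
  have -> : h x = seg (g x) (f x) t%:num by rewrite /h /seg; ring.
  by apply: mem_seg => //; rewrite t0 t1.
have hm : has_mean mu h
    (t%:num * (\int[mu]_x f x) + (1 - t%:num) * (\int[mu]_x g x)).
  by apply: has_meanD; apply: has_meanZ; exact: L1Phi_has_mean.
split=> //; first by case: hm.
(* Any point of [I] could carry the tangent line; this one is at hand. *)
pose b := \int[mu]_x f x; have Ib : I b by exact: L1Phi_mean_mem.
have lm : has_mean mu (fun x => Phi b + dPhi b * (h x - b)) (Phi b +
    dPhi b * (t%:num * (\int[mu]_x f x) + (1 - t%:num) * (\int[mu]_x g x) - b)).
  apply: has_meanD; first exact: has_mean_cst.
  by apply: has_meanZ; apply: has_meanB => //; exact: has_mean_cst.
have um : has_mean mu (fun x => t%:num * Phi (f x) + (1 - t%:num) * Phi (g x))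
    (t%:num * (\int[mu]_x Phi (f x)) + (1 - t%:num) * (\int[mu]_x Phi (g x))).
  by apply: has_meanD; apply: has_meanZ; exact: L1Phi_has_mean_comp.
apply: (integrable_sandwich mu _ _ _ _ lm.1 um.1).
  exact: (measurable_derivable_within_comp _ _ _ I_itv (Phi_smooth 0) mh hI).
move=> x; apply/andP; split.
  (* With base point [(b, b)] and second argument fixed at [b], the tangent inequality says
     [0 <= bregman (h x) b]. *)
  have := tangent b (h x) b b Ib (hI x) Ib Ib.
  by rewrite /bregman -/dPhi /=; lra.
have := Phi_convex t (f x) (g x); rewrite !inE => /(_ (fI x) (gI x)).
by [].
Qed.

(** With [D] the divergence and [a], [b], [c] the means of [h], [f], [g], the convexity gap is the
    integral of [t D(f,h) + (1-t) D(g,h)] minus [t D(b,a) + (1-t) D(c,a)]. *)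
Lemma Ent_conv (t : {i01 R}) f g : L1Phi mu I Phi f -> L1Phi mu I Phi g ->
  Ent mu Phi (fun x => t%:num * f x + (1 - t%:num) * g x) <=
  t%:num * Ent mu Phi f + (1 - t%:num) * Ent mu Phi g.
Proof.
move=> Lf Lg; have Lh := L1Phi_conv t f g Lf Lg.
have t0 : 0 <= t%:num by [].
have t1 : 0 <= 1 - t%:num by rewrite subr_ge0.
have fm := L1Phi_has_mean f Lf; have gm := L1Phi_has_mean g Lg.
have Pfm := L1Phi_has_mean_comp f Lf; have Pgm := L1Phi_has_mean_comp g Lg.
have Iha := L1Phi_mean_mem _ Lh.
have If := L1Phi_mean_mem _ Lf; have Ig := L1Phi_mean_mem _ Lg.
have hm := L1Phi_has_mean _ Lh; have Phm := L1Phi_has_mean_comp _ Lh.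
have hE : \int[mu]_x (t%:num * f x + (1 - t%:num) * g x) =
    t%:num * (\int[mu]_x f x) + (1 - t%:num) * (\int[mu]_x g x).
  by case: (has_meanD mu _ _ _ _ (has_meanZ mu _ _ t%:num fm)
                                 (has_meanZ mu _ _ (1 - t%:num) gm)).
move: Iha hm Phm; rewrite /Ent /= hE.
move: fm gm Pfm Pgm If Ig; clear hE.
set b := \int[mu]_x f x; set c := \int[mu]_x g x.
set A := \int[mu]_x Phi (f x); set B := \int[mu]_x Phi (g x).
set a := t%:num * b + _ * c => fm gm Pfm Pgm If Ig Ia hm Phm.
set C := \int[mu]_x Phi _ in Phm *.
set h := fun x => _ in hm Phm.
(* The weighted tangent planes at [(b, a)] and [(c, a)]; the constant is [t D(b,a) + (1-t) D(c,a)],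
   simplified by [a = t b + (1-t) c]. *)
have lm : has_mean mu (fun x =>
    (t%:num * Phi b + (1 - t%:num) * Phi c - Phi a) +
    (t%:num * (dPhi b - dPhi a)) * (f x - b) +
    ((1 - t%:num) * (dPhi c - dPhi a)) * (g x - c) -
    (phi a * (t%:num * (b - a) + (1 - t%:num) * (c - a))) * (h x - a))
    ((t%:num * Phi b + (1 - t%:num) * Phi c - Phi a) + 0 + 0 - 0).
  apply: has_meanB; last exact: has_mean_centered.
  apply: has_meanD; last exact: has_mean_centered.
  apply: has_meanD; last exact: has_mean_centered.
  exact: has_mean_cst.
have um : has_mean mu
    (fun x => t%:num * Phi (f x) + (1 - t%:num) * Phi (g x) - Phi (h x))
    (t%:num * A + (1 - t%:num) * B - C).
  by apply: has_meanB => //; apply: has_meanD; exact: has_meanZ.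
have : t%:num * Phi b + (1 - t%:num) * Phi c - Phi a + 0 + 0 - 0 <=
    t%:num * A + (1 - t%:num) * B - C; last by lra.
(* The [t]-average of the tangent inequalities at [(f, h)] and [(g, h)]: the
   terms in [dPhi (h x)] cancel. *)
apply: (le_has_mean mu _ _ _ _ lm um) => x.
have [_ fI _ _] := Lf; have [_ gI _ _] := Lg; have [_ hI _ _] := Lh.
have H1 := ler_wpM2l t0 (tangent (h x) (f x) a b (hI x) (fI x) Ia If).
have H2 := ler_wpM2l t1 (tangent (h x) (g x) a c (hI x) (gI x) Ia Ig).
move: H1 H2; rewrite /bregman -/dPhi -/phi.
have hE : h x = t%:num * f x + (1 - t%:num) * g x by [].
(* Abstracting these values keeps [h x] and [a] from being expanded inside them. *)
move: (Phi (h x)) (dPhi (h x)) (Phi a) (dPhi a) (phi a) => u1 u2 u3 u4 u5.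
by rewrite hE /a; lra.
Qed.

(** The integrand is [Phi f - Phi h - D(f,h) - dPhi a * (f - h)]. Bounding [D(f,h)] below by its
    tangent plane at the means gives an integrable majorant of mean [Ent f - Ent h]; the integrand
    itself may have integral minus infinity, hence the extended reals. *)
Lemma Ent_ge_duality f h : L1Phi mu I Phi f -> L1Phi mu I Phi h ->
  (\int[mu]_x ((dPhi (h x) - dPhi (\int[mu]_y h y)) * (f x - h x))%:E +
   (Ent mu Phi h)%:E <= (Ent mu Phi f)%:E)%E.
Proof.
move=> Lf Lh; have [mf fI _ _] := Lf; have [mh hI _ _] := Lh.
have Ib := L1Phi_mean_mem f Lf; have Ia := L1Phi_mean_mem h Lh.
have fm := L1Phi_has_mean f Lf; have hm := L1Phi_has_mean h Lh.
have Pfm := L1Phi_has_mean_comp f Lf; have Phm := L1Phi_has_mean_comp h Lh.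
rewrite /Ent; move: Ib Ia fm hm Pfm Phm.
set b := \int[mu]_x f x; set a := \int[mu]_x h x => Ib Ia fm hm Pfm Phm.
have um : has_mean mu (fun x => (Phi (f x) - Phi (h x)) -
    ((bregman I Phi b a + (dPhi b - dPhi a) * (f x - b)) -
      (phi a * (b - a)) * (h x - a)) - dPhi a * (f x - h x))
    ((\int[mu]_x Phi (f x) - \int[mu]_x Phi (h x)) -
     ((bregman I Phi b a + 0) - 0) - dPhi a * (b - a)).
  apply: has_meanB; last exact/has_meanZ/has_meanB.
  apply: has_meanB; first exact: has_meanB.
  apply: has_meanB; last exact: has_mean_centered.
  apply: has_meanD; last exact: has_mean_centered.
  exact: has_mean_cst.
have mG : measurable_fun setT (fun x => (dPhi (h x) - dPhi a) * (f x - h x)).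
  apply: measurable_funM; apply: measurable_funB => //.
  exact: (measurable_derivable_within_comp _ _ _ I_itv (Phi_smooth 1) mh hI).
have /leeD2r : (\int[mu]_x ((dPhi (h x) - dPhi a) * (f x - h x))%:E <=
    ((\int[mu]_x Phi (f x) - Phi b) - (\int[mu]_x Phi (h x) - Phi a))%:E)%E.
  have -> : (\int[mu]_x Phi (f x) - Phi b) - (\int[mu]_x Phi (h x) - Phi a) =
     (\int[mu]_x Phi (f x) - \int[mu]_x Phi (h x)) -
     ((bregman I Phi b a + 0) - 0) - dPhi a * (b - a).
    by rewrite /bregman -/dPhi; ring.
  apply: (integral_le_has_mean mu _ _ _ mG um) => x.
  have := tangent (h x) (f x) a b (hI x) (fI x) Ia Ib.
  by rewrite /bregman -/dPhi -/phi; lra.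
move=> /(_ (\int[mu]_x Phi (h x) - Phi a)%:E).
by rewrite -EFinD subrK.
Qed.

End L1Phi_theory.

Theorem proposition4 (R : realType) (I : set R) (Phi : R -> R)
    (d : measure_display) (T : measurableType d) (mu : probability T R)
    (I_itv : is_interval I) (I_closed : closed I)
    (Phi_smooth : smooth_within I Phi)
    (Phi_convex : @convex_function R R^o I Phi)
    (Phi2_ge0 : forall u v : R, I u -> I v ->
       0 <= derive_withinn I 2 Phi u * v ^+ 2)
    (Phi2_convex : @convex_function R (R^o * R^o)%type (I `*` I)
       (fun p : R * R => derive_withinn I 2 Phi p.1 * p.2 ^+ 2)) :
  [/\ @convex_set R (T -> R^o) (L1Phi mu I Phi),
      @convex_function R (T -> R^o) (L1Phi mu I Phi) (Ent mu Phi) &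
      forall f : T -> R, L1Phi mu I Phi f ->
        (Ent mu Phi f)%:E =
        ereal_sup [set ((\int[mu]_x
                           ((derive_within I Phi (h x) -
                             derive_within I Phi (\int[mu]_y h y)) *
                            (f x - h x))%:E) + (Ent mu Phi h)%:E)%E
                  | h in L1Phi mu I Phi]].
Proof.
split.
- move=> f g t; rewrite !inE => Lf Lg.
  exact: (L1Phi_conv mu I I_itv I_closed Phi Phi_smooth Phi_convex Phi2_ge0
    Phi2_convex t f g Lf Lg).
- move=> t f g; rewrite !inE => Lf Lg.
  exact: (Ent_conv mu I I_itv I_closed Phi Phi_smooth Phi_convex Phi2_ge0
    Phi2_convex t f g Lf Lg).
- move=> f Lf; apply/eqP; rewrite eq_le; apply/andP; split.
    (* At [h = f] the integrand vanishes and only [Ent mu Phi f] is left. *)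
    apply: ereal_sup_ubound; exists f => //.
    under eq_integral do rewrite subrr mulr0.
    by rewrite integral0 add0e.
  apply: ge_ereal_sup => _ [h Lh <-]; exact: Ent_ge_duality.
Qed.
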